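(* Consider a POMDP with finite state space $\mathcal S$, finite observation space $\mathcal Y$, finite action space $\mathcal A$, transition kernel $P(s'\mid s,a)$, observation kernel $O(y'\mid s',a)$, reward $r\colon\mathcal S\times\mathcal A\to\mathbb R$, and discount $\gamma\in[0,1)$. Let $\mathcal Z$ be a finite set and $f\colon\mathcal Z\times\mathcal Y\times\mathcal A\to\mathcal Z$ a recurrent update, with agent state $Z_{t+1}=f(Z_t,Y_{t+1},A_t)$. Let the exploration policy $\pi_{\mathrm{expl}}\colon\mathcal Z\to\Delta(\mathcal A)$ (with $A_t\sim\pi_{\mathrm{expl}}(Z_t)$) be such that the Markov chain $\{(S_t,Y_t,Z_t,A_t)\}_{t\ge1}$ has a unique stationary distribution $\xi$ with $\xi(s,y,z,a)>0$ for all $(s,y,z,a)$. Consider the recurrent Q-learning iterates $$\widehat Q_{t+1}(Z_t,A_t)=\widehat Q_t(Z_t,A_t)+\alpha_t(Z_t,A_t)\big[R_t+\gamma\max_{\tilde a\in\mathcal A}\widehat Q_t(Z_{t+1},\tilde a)-\widehat Q_t(Z_t,A_t)\big],$$ where $R_t=r(S_t,A_t)$ and the learning rate is $\alpha_t(z,a)=\mathbb 1\{Z_t=z,A_t=a\}\big/\big(1+\sum_{\tau=0}^t\mathbb 1\{Z_\tau=z,A_\tau=a\}\big)$ (entries other than $(Z_t,A_t)$ are unchanged). Define $$r_\xi(z,a)=\sum_{s}r(s,a)\xi(s\mid z,a),\qquad P_\xi(z'\mid z,a)=\sum_s\xi(s\mid z,a)\sum_{s'}P(s'\mid s,a)\sum_{y'}O(y'\mid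 s',a)\mathbb 1\{z'=f(z,y',a)\},$$ and let $Q^\star_\xi$ be the unique fixed point of $$Q^\star_\xi(z,a)=r_\xi(z,a)+\gamma\sum_{z'\in\mathcal Z}P_\xi(z'\mid z,a)\max_{\tilde a\in\mathcal A}Q^\star_\xi(z',\tilde a).$$ Then $\widehat Q_t\to Q^\star_\xi$ almost surely. Therefore the greedy policies $\hat\pi_t(z)=\arg\max_a\widehat Q_t(z,a)$ converge to $\pi^\star_\xi(z)=\arg\max_aQ^\star_\xi(z,a)$ (arg-max ties broken by a fixed deterministic rule).
   Context: $\xi(s\mid z,a)=\xi(s,z,a)/\xi(z,a)$ denotes the conditional of the marginal of $\xi$ on $(s,z,a)$. $\Delta(\mathcal A)$ is the set of probability distributions on $\mathcal A$.
   Formalization: Convergence of the greedy policies is stated under the added assumption that the maximiser of Q*_ξ(z,·) is unique for every z; with ties the greedy action can oscillate forever (e.g. γ=0, i.i.d. fair ±1 rewards for two actions), whatever fixed tie-breaking rule is used. *)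

(* Defs.v *)
From HB Require Import structures.
From mathcomp Require Import all_boot all_order all_algebra.
From mathcomp Require Import all_classical all_reals all_analysis.
Set Implicit Arguments. Unset Strict Implicit. Unset Printing Implicit Defensive.
Import Order.TTheory GRing.Theory Num.Theory.
Local Open Scope ring_scope.

Section POMDP.
Variables (R : realType) (S Y Z A : finType).

Definition state := (S * Y * Z * A)%type.
Definition sof (x : state) : S := x.1.1.1.
Definition yof (x : state) : Y := x.1.1.2.
Definition zof (x : state) : Z := x.1.2.
Definition aof (x : state) : A := x.2.

Definition is_dist (T : finType) (p : T -> R) : Prop :=
  (forall x, 0 <= p x) /\ \sum_x p x = 1.

Definition chain_kernel (P : S -> A -> S -> R) (O : S -> A -> Y -> R)
  (f : Z -> Y -> A -> Z) (pi : Z -> A -> R) (x x' : state) : R :=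
  P (sof x) (aof x) (sof x') * O (sof x') (aof x) (yof x')
  * (if zof x' == f (zof x) (yof x') (aof x) then 1 else 0)
  * pi (zof x') (aof x').

Definition is_stationary (K : state -> state -> R) (xi : state -> R) : Prop :=
  is_dist xi /\ forall x', \sum_x xi x * K x x' = xi x'.

Definition xi_sza (xi : state -> R) (s : S) (z : Z) (a : A) : R :=
  \sum_y xi (s, y, z, a).
Definition xi_za (xi : state -> R) (z : Z) (a : A) : R :=
  \sum_s xi_sza xi s z a.
Definition xi_cond (xi : state -> R) (s : S) (z : Z) (a : A) : R :=
  xi_sza xi s z a / xi_za xi z a.

Definition r_xi (xi : state -> R) (r : S -> A -> R) (z : Z) (a : A) : R :=
  \sum_s r s a * xi_cond xi s z a.

Definition P_xi (xi : state -> R) (P : S -> A -> S -> R) (O : S -> A -> Y -> R)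
  (f : Z -> Y -> A -> Z) (z' : Z) (z : Z) (a : A) : R :=
  \sum_s xi_cond xi s z a *
    \sum_s' P s a s' * \sum_y' O s' a y' * (if z' == f z y' a then 1 else 0).

(* max_{a} Q(z, a)  (A is nonempty whenever some pi(z) is a distribution) *)
Definition qmax (Q : Z -> A -> R) (z : Z) : R :=
  match [pick a : A] with
  | Some a0 => \big[Num.max/Q z a0]_(a : A) Q z a
  | None => 0
  end.

Definition greedy (a0 : A) (Q : Z -> A -> R) (z : Z) : A :=
  Order.arg_max a0 xpredT (fun a => Q z a).

Definition visits (traj : nat -> state) (t : nat) (z : Z) (a : A) : R :=
  \sum_(tau < t.+1) (if (zof (traj tau) == z) && (aof (traj tau) == a) then 1 else 0).

Definition alpha (traj : nat -> state) (t : nat) (z : Z) (a : A) : R :=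
  (if (zof (traj t) == z) && (aof (traj t) == a) then 1 else 0)
  / (1 + visits traj t z a).

Fixpoint Qhat (r : S -> A -> R) (gamma : R) (traj : nat -> state)
  (Q0 : Z -> A -> R) (t : nat) : Z -> A -> R :=
  match t with
  | 0 => Q0
  | t'.+1 =>
    let Q := Qhat r gamma traj Q0 t' in
    fun z a => Q z a + alpha traj t' z a *
      (r (sof (traj t')) (aof (traj t')) + gamma * qmax Q (zof (traj t'.+1))
       - Q (zof (traj t')) (aof (traj t')))
  end.

End POMDP.

(* Main.v *)
(** With the learning rate [1 / (1 + visits)], the entry [Q_t(z, a)] is the plain
    average of its initial value and of the targets
    [R_tau + gamma max Q_tau(Z_{tau+1})] over the past visits [tau] of [(z, a)].
    Replacing [Q_tau] by [Qstar] in the targets gives averages that converge to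
    [Qstar(z, a)] by the ergodic theorem, and costs at most [gamma] times the
    average of the past sup-norm errors.  Hence [limsup |Q_t - Qstar|] is at most
    [gamma] times itself, and it is finite, so it vanishes.

    For the ergodic theorem, the indicators of the transitions minus their
    conditional probabilities are martingale differences.  Their partial sums [M_n]
    satisfy [E M_n^2 <= C^2 n], so [M_n / n] tends to 0 almost surely along the
    squares, hence along all [n].  Every limit of the empirical frequencies is
    therefore invariant, and the invariant distribution is unique. *)
Require Import Defs.
From HB Require Import structures.
From mathcomp Require Import all_boot all_order all_algebra.
From mathcomp Require Import all_classical all_reals all_analysis.
From mathcomp Require Import measurable_realfun.
From mathcomp Require Import ring lra zify.
Import Order.TTheory GRing.Theory Num.Theory.
Import numFieldNormedType.Exports.
Local Open Scope classical_set_scope.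
Local Open Scope ring_scope.

(** * Second moments along histories of a Markov chain *)

(* Histories of length [n.+1], as an iterated product so that sums over them
   unfold one step at a time. *)
Fixpoint history (E : finType) (n : nat) : finType :=
  if n is m.+1 then (history E m * E)%type else E.

Definition history_last {E : finType} {n : nat} : history E n -> E :=
  match n with 0 => id | _.+1 => snd end.

Fixpoint history_nth {E : finType} {n : nat} : history E n -> nat -> E :=
  match n with
  | 0 => fun u _ => u
  | m.+1 => fun u t => if (t <= m)%N then history_nth u.1 t else u.2
  end.

Fixpoint history_of {E : finType} (x : nat -> E) (n : nat) : history E n :=
  match n with 0 => x 0%N | m.+1 => (history_of x m, x m.+1) end.

Fixpoint history_prob {R : realType} {E : finType} (mu0 : E -> R)
    (K : E -> E -> R) {n : nat} : history E n -> R :=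
  match n with
  | 0 => mu0
  | m.+1 => fun u => history_prob mu0 K u.1 * K (history_last u.1) u.2
  end.

Fixpoint history_sum {R : realType} {E : finType} (G : E -> E -> R) {n : nat} :
    history E n -> R :=
  match n with
  | 0 => fun=> 0
  | m.+1 => fun u => history_sum G u.1 + G (history_last u.1) u.2
  end.

Lemma history_last_of (E : finType) (x : nat -> E) n :
  history_last (history_of x n) = x n.
Proof. by case: n. Qed.

Lemma history_last_nth (E : finType) n (u : history E n) :
  history_last u = history_nth u n.
Proof. by case: n u => [|n] //= u; rewrite ltnn. Qed.

Lemma history_of_eq (E : finType) (x : nat -> E) n (u : history E n) :
  history_of x n = u <-> forall t, (t <= n)%N -> x t = history_nth u t.
Proof.
elim: n u => [|n IH] u /=.
  by split=> [<- t|/(_ 0%N)->//]; rewrite leqn0 => /eqP->.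
split=> [<- t /=|xu].
  rewrite leq_eqVlt => /orP[/eqP->|]; first by rewrite ltnn.
  by rewrite ltnS => tn; rewrite tn; apply: (IH _).1.
rewrite [u]surjective_pairing; congr pair.
  by apply/IH => t tn; rewrite xu ?tn// ltnW.
by rewrite xu// ltnn.
Qed.

Lemma history_probE (R : realType) (E : finType) (mu0 : E -> R)
    (K : E -> E -> R) n (u : history E n) :
  history_prob mu0 K u = mu0 (history_nth u 0%N) *
    \prod_(t < n) K (history_nth u t) (history_nth u t.+1).
Proof.
elim: n u => [|n IH] u /=; first by rewrite big_ord0 mulr1.
rewrite big_ord_recr /= ltnn leqnn IH mulrA history_last_nth.
congr (_ * _ * _); apply: eq_bigr => i _.
by rewrite (ltn_ord i) (ltnW (ltn_ord i)).
Qed.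

Lemma history_sum_of (R : realType) (E : finType) (G : E -> E -> R)
    (x : nat -> E) n :
  history_sum G (history_of x n) = \sum_(t < n) G (x t) (x t.+1).
Proof.
elim: n => [|n IH] /=; first by rewrite big_ord0.
by rewrite IH big_ord_recr history_last_of.
Qed.

Section second_moment.
Variables (R : realType) (E : finType) (mu0 : E -> R) (K : E -> E -> R).
Hypotheses (mu0_dist : is_dist mu0) (K_dist : forall x, is_dist (K x)).

Lemma history_prob_ge0 n (u : history E n) : 0 <= history_prob mu0 K u.
Proof.
elim: n u => [|n IH] u /=; first by apply mu0_dist.1.
by rewrite mulr_ge0// (K_dist _).1.
Qed.

Lemma sum_historyS n (F : history E n.+1 -> R) :
  \sum_(u : history E n.+1) F u = \sum_(v : history E n) \sum_b F (v, b).
Proof. by rewrite pair_bigA; apply: eq_bigr => -[]. Qed.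

Lemma history_prob_sum1 n : \sum_(u : history E n) history_prob mu0 K u = 1.
Proof.
elim: n => [|n IH]; first by rewrite mu0_dist.2.
rewrite sum_historyS -[RHS]IH; apply: eq_bigr => v _ /=.
by rewrite -mulr_sumr (K_dist _).2 mulr1.
Qed.

(* The increments are martingale differences, so the cross term vanishes when
   conditioning on the history. *)
Lemma history_second_moment (G : E -> E -> R) (C : R) n :
  (forall x, \sum_y K x y * G x y = 0) -> (forall x y, `|G x y| <= C) ->
  \sum_(u : history E n) history_sum G u ^+ 2 * history_prob mu0 K u <= C ^+ 2 *+ n.
Proof.
move=> KG GC; elim: n => [|n IH].
  by rewrite mulr0n big1// => u _ /=; rewrite expr0n mul0r.
rewrite sum_historyS mulrS addrC.
(* For each history, one more step adds at most [C ^+ 2] to the conditional mean of the square. *)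
apply: (@le_trans _ _ (\sum_(v : history E n)
  (history_sum G v ^+ 2 + C ^+ 2) * history_prob mu0 K v)); last first.
  under eq_bigr do rewrite mulrDl.
  by rewrite big_split/= -mulr_sumr history_prob_sum1 mulr1 lerD2r.
apply: ler_sum => v _ /=.
set m := history_sum _ _; set q := history_prob _ _ _; set l := history_last _.
have -> : \sum_b (m + G l b) ^+ 2 * (q * K l b) =
    (m ^+ 2 + \sum_b K l b * G l b ^+ 2) * q.
  rewrite mulrDl.
  (* The row of [K] has mass one and the cross term is zero by [KG], so inserting both changes
     nothing and completes the square under the sum. *)
  have -> : m ^+ 2 * q = m ^+ 2 * q * \sum_b K l b + 2 * m * q * \sum_b K l b * G l b.
    by rewrite KG (K_dist l).2; ring.
  rewrite mulr_suml !mulr_sumr -!big_split/=; apply: eq_bigr => b _; ring.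
rewrite ler_wpM2r ?history_prob_ge0// lerD2l.
rewrite -[leRHS]mulr1 -(K_dist l).2 mulr_sumr; apply: ler_sum => b _.
rewrite mulrC ler_wpM2r ?(K_dist l).1//.
by rewrite -real_normK ?num_real// lerXn2r ?nnegrE// (le_trans _ (GC l b)).
Qed.

End second_moment.

(** * Functions of finite range and averages along the squares *)

Lemma le_sum2_norm {R : realType} (I J : finType) (F : I -> J -> R) i j :
  `|F i j| <= \sum_i \sum_j `|F i j|.
Proof.
rewrite (bigD1 i)//= (bigD1 j)//= -addrA lerDl addr_ge0//; first exact: sumr_ge0.
by apply: sumr_ge0 => k _; exact: sumr_ge0.
Qed.

(** The integrand is a finite combination of indicators of the fibres of [W]. Measurability is asked
    of the fibres, so that [I] carries no sigma-algebra. *)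
Lemma ge0_integral_finite_range {d : measure_display} {T : measurableType d} {R : realType}
    (mu : {measure set T -> \bar R}) (I : finType) (W : T -> I) (F : I -> R) :
  (forall i, measurable [set w | W w = i]) -> (forall i, 0 <= F i) ->
  (\int[mu]_w (F (W w))%:E = \sum_i (F i)%:E * mu [set w | W w = i])%E.
Proof.
move=> mW F0.
transitivity (\int[mu]_w (\sum_i (F i)%:E * (\1_[set w | W w = i] w)%:E))%E.
  apply: eq_integral => w _.
  rewrite (bigD1 (W w))//= big1 ?adde0 => [|i /eqP iW].
    by rewrite indicE mem_set// mule1.
  by rewrite indicE memNset ?mule0// => /esym.
rewrite ge0_integral_sum//.
- apply: eq_bigr => i _; rewrite ge0_integralZl_EFin//.
  + by rewrite integral_indic// setIT.
  + by apply/measurable_EFinP; exact: measurable_indic.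
- move=> i; apply: emeasurable_funM => //.
  by apply/measurable_EFinP; exact: measurable_indic.
- by move=> i w _; rewrite mule_ge0// lee_fin.
Qed.

Lemma measurable_fun_finite_range {d : measure_display} {T : measurableType d} {R : realType}
    (I : finType) (W : T -> I) (F : I -> R) :
  (forall i, measurable [set w | W w = i]) -> measurable_fun setT (fun w => F (W w)).
Proof.
move=> mW.
have -> : (fun w => F (W w)) = (fun w => \sum_i F i * \1_[set w | W w = i] w).
  apply/funext => w.
  rewrite (bigD1 (W w))//= big1 ?addr0 => [|i /eqP iW].
    by rewrite indicE mem_set// mulr1.
  by rewrite indicE memNset ?mulr0// => /esym.
apply: measurable_sum => i; apply: measurable_funM => //.
Qed.

Lemma sum_inv_sqr_le {R : realType} n : \sum_(k < n) (k.+1%:R ^+ 2)^-1 <= 2 :> R.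
Proof.
(* This sharper bound is inductive, since 1/(x+1)^2 <= 1/x - 1/(x+1) for x > 0. At [n = 0] the
   inverse is 0 by convention. *)
suff : \sum_(k < n) (k.+1%:R ^+ 2)^-1 <= 2 - n%:R^-1 :> R.
  by move/le_trans; apply; rewrite gerBl invr_ge0.
elim: n => [|[|n] IH]; first by rewrite big_ord0 invr0; lra.
  by rewrite big_ord1 expr1n !invr1; lra.
rewrite big_ord_recr/= (le_trans (lerD IH (lexx _)))//.
have n1 : 0 < n.+1%:R :> R by rewrite ltr0n.
rewrite -[n.+2%:R]natr1; move: n1; set x := n.+1%:R => x0.
rewrite -addrA lerD2l -subr_ge0.
have -> : - (x + 1)^-1 - (- x^-1 + ((x + 1) ^+ 2)^-1) = x^-1 * ((x + 1) ^+ 2)^-1.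
  by field; lra.
by rewrite mulr_ge0// invr_ge0 ?sqr_ge0// ltW.
Qed.

(* An increment bound controls the gaps between consecutive squares. *)
Lemma cvg_mean_from_squares {R : realType} (M : nat -> R) (C : R) :
  (forall n, `|M n.+1 - M n| <= C) ->
  (fun n => M (n.+1 ^ 2)%N / (n.+1 ^ 2)%:R) @ \oo --> 0 ->
  (fun n => M n / n%:R) @ \oo --> 0.
Proof.
move=> MC M0.
have C0 : 0 <= C by apply: le_trans (MC 0%N).
have MD n k : `|M (n + k)%N - M n| <= C *+ k.
  elim: k => [|k IH]; first by rewrite addn0 subrr normr0.
  rewrite addnS mulrS.
  have -> : M (n + k).+1 - M n = (M (n + k).+1 - M (n + k)%N) + (M (n + k)%N - M n) by ring.
  by rewrite (le_trans (ler_normD _ _))// lerD.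
apply/cvgr0Pnorm_le => e e0.
have e2 : 0 < e / 2 by lra.
have [N _ NM] := (cvgr0Pnorm_le _).1 M0 _ e2.
(* From this index on, the drift [C * (3 * m.+1)] over a gap between squares is at most [e / 2]
   times [m.+1 ^ 2]. *)
have [N1 N1C] : exists N1 : nat, 6 * C / e <= N1%:R.
  exists (Num.truncn (6 * C / e)).+1; apply/ltW; exact: truncnS_gt.
exists ((maxn N N1).+1 ^ 2)%N => // t /= Nt.
have [m [mN mt tm]] : exists m, [/\ (maxn N N1 <= m)%N, (m.+1 ^ 2 <= t)%N & (t < m.+2 ^ 2)%N].
  elim: t Nt => [|t IH]; first by rewrite leqn0 expn_eq0.
  rewrite leq_eqVlt => /orP[/eqP <-|].
    by exists (maxn N N1); split=> //; rewrite ltn_exp2r.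
  rewrite ltnS => /IH [m [mN mt tm]].
  have [tm'|tm'] := ltnP t.+1 (m.+2 ^ 2); first by exists m; split=> //; rewrite (leq_trans mt).
  exists m.+1; split; [exact: leq_trans mN _|exact: tm'|].
  by rewrite (leq_ltn_trans tm)// ltn_exp2r.
have t0 : 0 < t%:R :> R by rewrite ltr0n (leq_trans _ mt)// expn_gt0.
rewrite normrM normfV (gtr0_norm t0) ler_pdivrMr//.
have Mm : `|M (m.+1 ^ 2)%N| <= e / 2 * (m.+1 ^ 2)%:R.
  have := NM m (leq_trans (leq_maxl _ _) mN).
  by rewrite normrM normfV (ger0_norm (ler0n _ _)) ler_pdivrMr// ltr0n expn_gt0.
have mt' : (m.+1 ^ 2)%:R <= t%:R :> R by rewrite ler_nat.
have := MD (m.+1 ^ 2)%N (t - m.+1 ^ 2)%N; rewrite subnKC// => Mt.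
(* The gap between the two squares is 2m + 3, so [t] exceeds the lower one by at most 2m + 2. *)
have kl : (t - m.+1 ^ 2 <= 3 * m.+1)%N.
  by rewrite leq_subLR -ltnS (leq_trans tm)// -!mulnn; lia.
have Cm : C * (3 * m.+1)%:R <= e / 2 * (m.+1 ^ 2)%:R.
  rewrite -mulnn !natrM mulrA [leRHS]mulrA ler_wpM2r//.
  have : 6 * C / e <= m.+1%:R.
    by rewrite (le_trans N1C)// ler_nat (leq_trans (leq_maxr N N1))// (leq_trans mN).
  by rewrite ler_pdivrMr//; lra.
have : C *+ (t - m.+1 ^ 2) <= C * (3 * m.+1)%:R.
  by rewrite -[leLHS]mulr_natr ler_wpM2l// ler_nat.
have : `|M t| <= `|M t - M (m.+1 ^ 2)%N| + `|M (m.+1 ^ 2)%N|.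
  by rewrite (le_trans _ (ler_normD _ _))// subrK.
have := ler_wpM2l (ltW e2) mt'; lra.
Qed.

(** * Laws of large numbers *)

(** The series of squares has a finite integral, hence is finite almost everywhere, and the terms of
    a convergent series tend to 0. *)
Lemma cvg0_ae_of_sum_second_moment {d : measure_display} {T : measurableType d}
    {R : realType} (mu : {measure set T -> \bar R}) (u : nat -> T -> R) (c : R) :
  (forall n, measurable_fun setT (u n)) ->
  (forall n, (\sum_(k < n) \int[mu]_w ((u k w) ^+ 2)%:E <= c%:E)%E) ->
  {ae mu, forall w, (fun n => u n w) @ \oo --> 0}.
Proof.
move=> mu_ uc.
pose v n w := ((u n w) ^+ 2)%:E.
have mv n : measurable_fun setT (v n).
  by apply/measurable_EFinP; exact: measurable_funX.
have v0 n w : (0 <= v n w)%E by rewrite lee_fin sqr_ge0.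
pose s w := (\sum_(n <oo) v n w)%E.
have s0 w : (0 <= s w)%E by apply: nneseries_ge0 => n _ _; exact: v0.
have ints : (\int[mu]_w s w <= c%:E)%E.
  rewrite integral_nneseries//; apply: lime_le.
    by apply: is_cvg_nneseries => n _ _; apply: integral_ge0.
  by apply: nearW => n; rewrite big_mkord.
have ints' : mu.-integrable setT s.
  apply/integrableP; split; first by apply: ge0_emeasurable_sum.
  under eq_integral do rewrite gee0_abs//.
  exact: le_lt_trans ints (ltry _).
have := integrable_ae measurableT ints'; apply: filterS => w /(_ Logic.I) sw.
have : cvgn (series (fun n => u n w ^+ 2)).
  apply: nondecreasing_is_cvgn.
    by apply/nondecreasing_seqP => n; rewrite seriesSr lerDl sqr_ge0.
  exists (fine (s w)) => _ [n _ <-].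
  rewrite -lee_fin fineK// /series/= -sumEFin.
  by apply: (@nneseries_lim_ge _ (fun n => v n w) xpredT 0%N) => k _ _; exact: v0.
move/cvg_series_cvg_0 => u0.
apply/cvgr0Pnorm_le => e e0.
have : 0 < e ^+ 2 by rewrite exprn_gt0.
move=> /((cvgr0Pnorm_le _).1 u0); apply: filterS => n.
by rewrite normrX ler_pXn2r// nnegrE ltW.
Qed.

Section markov_chain.
Context {R : realType} {E : finType}.
Variables (mu0 : E -> R) (K : E -> E -> R).
Hypotheses (mu0_dist : is_dist mu0) (K_dist : forall x, is_dist (K x)).
Context {d : measure_display} {T : measurableType d}.
Variables (Pr : probability T R) (X : nat -> T -> E).
Hypothesis X_meas : forall t x, measurable [set w | X t w = x].
Hypothesis X_law : forall (x : nat -> E) (n : nat),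
  Pr [set w : T | forall t, (t <= n)%N -> X t w = x t]
  = (mu0 (x 0%N) * \prod_(t < n) K (x t) (x t.+1))%:E.

Lemma history_eq_set n (u : history E n) :
  [set w | history_of (X ^~ w) n = u] =
  [set w : T | forall t, (t <= n)%N -> X t w = history_nth u t].
Proof. by apply/seteqP; split=> w /=; apply history_of_eq. Qed.

Lemma measurable_history n (u : history E n) :
  measurable [set w | history_of (X ^~ w) n = u].
Proof.
elim: n u => [|n IH] u /=; first exact: X_meas.
rewrite (_ : [set w | _] =
    [set w | history_of (X ^~ w) n = u.1] `&` [set w | X n.+1 w = u.2]).
  exact: measurableI.
by case: u => v b; apply/seteqP; split=> w /= [-> ->].
Qed.

Lemma history_law n (u : history E n) :
  Pr [set w | history_of (X ^~ w) n = u] = (history_prob mu0 K u)%:E.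
Proof. by rewrite history_eq_set X_law history_probE. Qed.

Lemma integral_history n (F : history E n -> R) : (forall u, 0 <= F u) ->
  (\int[Pr]_w (F (history_of (X ^~ w) n))%:E =
   (\sum_u F u * history_prob mu0 K u)%:E)%E.
Proof.
move=> F0.
rewrite (@ge0_integral_finite_range _ _ _ _ _ (fun w => history_of (X ^~ w) n))//.
  by rewrite -sumEFin; apply: eq_bigr => u _; rewrite EFinM -history_law.
exact: measurable_history.
Qed.

(** The mean over (k+1)^2 steps has second moment at most C^2/(k+1)^2, which is summable. This gives
    convergence along the squares, and the bounded increments fill the gaps. *)
Lemma martingale_mean_cvg0 (G : E -> E -> R) :
  (forall x, \sum_y K x y * G x y = 0) ->
  {ae Pr, forall w,
    (fun n => (\sum_(t < n) G (X t w) (X t.+1 w)) / n%:R) @ \oo --> 0}.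
Proof.
move=> KG.
pose C := \sum_x \sum_y `|G x y|.
have GC x y : `|G x y| <= C by exact: le_sum2_norm.
pose u n w := (\sum_(t < n.+1 ^ 2) G (X t w) (X t.+1 w)) / (n.+1 ^ 2)%:R.
have uE n w : u n w =
    (fun h => history_sum G h / (n.+1 ^ 2)%:R) (history_of (X ^~ w) (n.+1 ^ 2)).
  by rewrite history_sum_of.
have : {ae Pr, forall w, (fun n => u n w) @ \oo --> 0}.
  apply: (@cvg0_ae_of_sum_second_moment _ _ _ _ _ (C ^+ 2 * 2)) => [n|n].
    rewrite (_ : u n = fun w => (fun h => history_sum G h / (n.+1 ^ 2)%:R)
        (history_of (X ^~ w) (n.+1 ^ 2))); last exact/funext.
    apply: (measurable_fun_finite_range _ (fun w => history_of (X ^~ w) (n.+1 ^ 2))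
      (fun h => history_sum G h / (n.+1 ^ 2)%:R)).
    exact: measurable_history.
  apply: (@le_trans _ _ (\sum_(k < n) (C ^+ 2 * (k.+1%:R ^+ 2)^-1)%:E)%E).
    apply: lee_sum => k _; under eq_integral do rewrite uE.
    rewrite (@integral_history _ (fun h => (history_sum G h / (k.+1 ^ 2)%:R) ^+ 2)).
      rewrite lee_fin.
      under eq_bigr do rewrite exprMn mulrAC.
      rewrite -mulr_suml exprVn ler_pdivrMr ?exprn_gt0 ?ltr0n ?expn_gt0//.
      apply: le_trans (history_second_moment R E mu0 K mu0_dist K_dist _ C _ KG GC) _.
      rewrite le_eqVlt -mulr_natr natrX; apply/orP; left; apply/eqP.
      have : k.+1%:R != 0 :> R by rewrite pnatr_eq0.
      by move: (k.+1%:R) => x x0; field.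
    by move=> h; exact: sqr_ge0.
  by rewrite sumEFin lee_fin -mulr_sumr ler_wpM2l ?sqr_ge0// sum_inv_sqr_le.
apply: filterS => w uw.
apply: (cvg_mean_from_squares (fun n => \sum_(t < n) G (X t w) (X t.+1 w)) C) => // n.
by rewrite big_ord_recr/= addrAC subrr add0r.
Qed.

End markov_chain.

(** * Convergence of occupation frequencies to the stationary distribution *)

Lemma cvgn_sum {R : realType} (I : finType) (u : I -> nat -> R) (l : I -> R) :
  (forall i, (fun n => u i n) @ \oo --> l i) ->
  (fun n => \sum_i u i n) @ \oo --> \sum_i l i.
Proof. by move=> ul; apply: cvg_big => [|i _]; [exact: add_continuous|exact: ul]. Qed.

Lemma cvgn_bounded_div {R : realType} (u : nat -> R) (C : R) :
  (forall n, `|u n| <= C) -> (fun n => u n / n%:R) @ \oo --> 0.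
Proof.
move=> uC; apply/cvgr0Pnorm_le => e e0.
exists (Num.truncn (C / e)).+1 => // n /= Cn.
have n0 : 0 < n%:R :> R by rewrite ltr0n (leq_trans _ Cn).
rewrite normrM normfV (gtr0_norm n0) ler_pdivrMr// (le_trans (uC n))//.
rewrite mulrC -ler_pdivrMr//; apply: le_trans (ltW (truncnS_gt _)) _.
by rewrite ler_nat.
Qed.

Section unique_stationary.
Context {R : realType} {E : finType}.
Variables (K : E -> E -> R) (xi : E -> R).
Hypothesis K_dist : forall x, is_dist (K x).
Hypotheses (xi_dist : is_dist xi) (xi_pos : forall x, 0 < xi x).
Hypothesis xi_stat : forall y, \sum_x xi x * K x y = xi y.
Hypothesis xi_uniq : forall nu, is_dist nu ->
  (forall y, \sum_x nu x * K x y = nu y) -> nu = xi.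

(* A small multiple of a signed invariant measure can be added to the positive
   [xi] without leaving the set of stationary distributions. *)
Lemma signed_stationary_eq0 (nu : E -> R) :
  (forall y, \sum_x nu x * K x y = nu y) -> \sum_x nu x = 0 ->
  forall x, nu x = 0.
Proof.
move=> nu_stat nu_sum.
(* Dividing by [c] brings every [|nu x|] below [xi x]; the leading 1 keeps [c] positive. *)
pose c := 1 + \sum_x `|nu x| / xi x.
have s0 : 0 <= \sum_x `|nu x| / xi x.
  by apply: sumr_ge0 => x _; rewrite divr_ge0// ltW.
have c0 : 0 < c by rewrite /c; lra.
have nu_le x : `|nu x| / c <= xi x.
  rewrite ler_pdivrMr// mulrC -ler_pdivrMr// /c (bigD1 x)//=.
  rewrite addrCA lerDl addr_ge0//.
  by apply: sumr_ge0 => y _; rewrite divr_ge0// ltW.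
have : (fun x => xi x + nu x / c) = xi.
  apply: xi_uniq => [|y].
    split=> [x|].
      have := nu_le x; rewrite -[in `|_| / c](gtr0_norm c0) -normf_div ler_norml.
      by move=> /andP[+ _]; lra.
    by rewrite big_split/= -mulr_suml nu_sum mul0r addr0; exact: xi_dist.2.
  under eq_bigr do rewrite mulrDl mulrAC.
  by rewrite big_split/= -mulr_suml xi_stat nu_stat.
move=> /(congr1 (fun h => h _)) nu0 x; move: (nu0 x) => /eqP.
rewrite -[eqbRHS]addr0 (inj_eq (addrI _)) mulf_eq0 invr_eq0 (gt_eqF c0) orbF.
by move/eqP.
Qed.

(** The square system sending [nu] to its invariance defect plus its mass times [xi] has trivial
    kernel, hence an inverse [B]. It recovers [nu] linearly from its defect and mass, so limits pass
    through without extracting subsequences. *)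
Lemma stationary_left_inverse : exists B : E -> E -> R, forall (nu : E -> R) x,
  nu x = \sum_y (nu y - \sum_z nu z * K z y + (\sum_z nu z) * xi y) * B y x.
Proof.
pose M : 'M[R]_#|E| := \matrix_(i, j) ((i == j)%:R
  - K (enum_val i) (enum_val j) + xi (enum_val j)).
pose vec (nu : E -> R) : 'rV[R]_#|E| := \row_i nu (enum_val i).
have sumE (F : E -> R) : \sum_(i < #|E|) F (enum_val i) = \sum_x F x.
  by rewrite [RHS](reindex _ (onW_bij _ (@enum_val_bij E))).
have vecM nu j : (vec nu *m M) 0 j = nu (enum_val j)
    - \sum_z nu z * K z (enum_val j) + (\sum_z nu z) * xi (enum_val j).
  rewrite mxE.
  under eq_bigr do rewrite !mxE mulrDr mulrBr.
  rewrite big_split/= -mulr_suml sumrB (bigD1 j)//= eqxx mulr1.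
  rewrite big1 ?addr0 => [|i /negbTE->]; last by rewrite mulr0.
  by rewrite -(sumE (fun z => nu z * K z (enum_val j))) -(sumE nu).
have M_unit : M \in unitmx.
  rewrite -row_free_unit; apply: inj_row_free => v vM.
  pose nu x := v 0 (enum_rank x).
  have vE : v = vec nu by apply/rowP => i; rewrite mxE /nu enum_valK.
  have nuE y : nu y - \sum_z nu z * K z y + (\sum_z nu z) * xi y = 0.
    by rewrite -[y]enum_rankK -vecM -vE vM mxE.
  (* Summing the coordinates cancels the defect, as the rows of [K] have mass one, and leaves the
     mass of [nu]. What remains says that [nu] is invariant. *)
  have nu_sum : \sum_z nu z = 0.
    transitivity (\sum_y (nu y - \sum_z nu z * K z y + (\sum_z nu z) * xi y)); last first.
      by rewrite big1.
    rewrite big_split/= sumrB -mulr_sumr xi_dist.2 mulr1 exchange_big/=.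
    under [X in _ - X]eq_bigr do rewrite -mulr_sumr (K_dist _).2 mulr1.
    by rewrite subrr add0r.
  rewrite vE; apply/rowP => i; rewrite !mxE; apply: signed_stationary_eq0 => // y.
  by apply/esym/eqP; rewrite -subr_eq0; have := nuE y; rewrite nu_sum mul0r addr0 => ->.
exists (fun y x => invmx M (enum_rank y) (enum_rank x)) => nu x.
have : vec nu = vec nu *m M *m invmx M by rewrite mulmxK.
move=> /rowP/(_ (enum_rank x)); rewrite mxE enum_rankK => ->; rewrite mxE.
rewrite -[RHS]sumE; apply: eq_bigr => j _.
by rewrite vecM enum_valK.
Qed.

Lemma asymptotically_stationary_cvg (nu : nat -> E -> R) :
  (fun n => \sum_x nu n x) @ \oo --> (1 : R) ->
  (forall y, (fun n => nu n y - \sum_x nu n x * K x y) @ \oo --> (0 : R)) ->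
  forall x, (fun n => nu n x) @ \oo --> xi x.
Proof.
move=> nu1 nu_stat x; have [B nuE] := stationary_left_inverse.
rewrite (nuE xi x) (_ : (fun n => nu n x) = fun n =>
  \sum_y (nu n y - \sum_z nu n z * K z y + (\sum_z nu n z) * xi y) * B y x); last first.
  by apply/funext => n; exact: nuE.
apply: cvgn_sum => y; apply: cvgMl; apply: cvgD.
  by rewrite xi_stat subrr; exact: nu_stat.
by rewrite xi_dist.2; exact: cvgMl.
Qed.

(** A statement about a single path: the invariance defect of the frequencies is a boundary term
    over [n] plus finitely many means that vanish by hypothesis. *)
Lemma occupation_cvg (x : nat -> E) :
  (forall a b, (fun n => (\sum_(t < n)
      (x t == a)%:R * ((x t.+1 == b)%:R - K a b)) / n%:R) @ \oo --> (0 : R)) ->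
  forall a, (fun n => (\sum_(t < n) (x t == a)%:R) / n%:R) @ \oo --> xi a.
Proof.
move=> xG; apply: asymptotically_stationary_cvg => [|b].
  (* The frequencies sum to 1 only from [n = 1] on; at [n = 0] division by zero gives 0. *)
  apply: cvg_near_cst; exists 1%N => // n /= n0.
  rewrite -mulr_suml exchange_big/=.
  under eq_bigr => t _.
    rewrite (bigD1 (x t))//= eqxx big1 ?addr0 => [|a]; last first.
      by rewrite eq_sym => /negbTE->.
    over.
  by rewrite sumr_const card_ord divff// pnatr_eq0 -lt0n.
(* The difference between the visits to [b] at times 0 to n-1 and at times 1 to n telescopes to
   [bd]. *)
pose bd n : R := (x 0%N == b)%:R - (x n == b)%:R.
have -> : (fun n => (\sum_(t < n) (x t == b)%:R) / n%:R
    - \sum_a (\sum_(t < n) (x t == a)%:R) / n%:R * K a b) =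
  (fun n => bd n / n%:R + \sum_a (\sum_(t < n)
      (x t == a)%:R * ((x t.+1 == b)%:R - K a b)) / n%:R).
  apply/funext => n.
  under [in RHS]eq_bigr do under eq_bigr do rewrite mulrBr.
  under [in RHS]eq_bigr do rewrite sumrB mulrBl.
  rewrite sumrB addrA; congr (_ - _); last first.
    by apply: eq_bigr => a _; rewrite -mulr_suml mulrAC.
  rewrite -mulr_suml -mulrDl; congr (_ / _).
  rewrite exchange_big/=.
  under eq_bigr do rewrite -?mulr_suml.
  rewrite [X in _ = _ + X](_ : _ = \sum_(t < n) (x t.+1 == b)%:R); last first.
    apply: eq_bigr => t _; rewrite (bigD1 (x t))//= eqxx mul1r big1 ?addr0// => a.
    by rewrite eq_sym => /negbTE->; rewrite mul0r.
  apply/eqP; rewrite -subr_eq; apply/eqP.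
  rewrite /bd -[RHS]opprB -(telescope_sumr (fun t => (x t == b)%:R : R))// big_mkord.
  by rewrite -sumrB -sumrN; apply: eq_bigr => t _; rewrite opprB.
have bd0 : (fun n => bd n / n%:R) @ \oo --> 0.
  apply: (cvgn_bounded_div _ 1) => n; rewrite /bd.
  by do 2 case: eqP => _; rewrite /= ?subrr ?subr0 ?sub0r ?normrN ?normr0 ?normr1.
have := cvgD bd0 (cvgn_sum E _ (fun=> 0) (fun a => xG a b)).
by rewrite big1// addr0; apply.
Qed.

(** The frequency of the transition from [a] to [b] is a vanishing mean plus the frequency of [a]
    times [K a b]. *)
Lemma transition_mean_cvg (x : nat -> E) (g : E -> E -> R) :
  (forall a b, (fun n => (\sum_(t < n)
      (x t == a)%:R * ((x t.+1 == b)%:R - K a b)) / n%:R) @ \oo --> (0 : R)) ->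
  (fun n => (\sum_(t < n) g (x t) (x t.+1)) / n%:R) @ \oo -->
    \sum_a \sum_b xi a * K a b * g a b.
Proof.
move=> xG; have xocc := occupation_cvg x xG.
have -> : (fun n => (\sum_(t < n) g (x t) (x t.+1)) / n%:R) =
  (fun n => \sum_a \sum_b ((\sum_(t < n) (x t == a)%:R * ((x t.+1 == b)%:R - K a b)) / n%:R
     + (\sum_(t < n) (x t == a)%:R) / n%:R * K a b) * g a b).
  apply/funext => n.
  transitivity (\sum_a \sum_b \sum_(t < n) ((x t == a)%:R * (x t.+1 == b)%:R * g a b) / n%:R).
    under [RHS]eq_bigr do rewrite exchange_big/=.
    rewrite exchange_big/= mulr_suml; apply: eq_bigr => t _.
    rewrite (bigD1 (x t))//= (bigD1 (x t.+1))//= !eqxx !mul1r.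
    rewrite big1 ?addr0 => [|b]; last first.
      by rewrite eq_sym => /negbTE->; rewrite mulr0 !mul0r.
    rewrite big1 ?addr0// => a; rewrite eq_sym => /negbTE->.
    by apply: big1 => b _; rewrite !mul0r.
  apply: eq_bigr => a _; apply: eq_bigr => b _.
  rewrite [(_ / _) * K a b]mulrAC -mulrDl !mulr_suml -big_split/= !mulr_suml.
  by apply: eq_bigr => t _; ring.
apply: cvgn_sum => a; apply: cvgn_sum => b; apply: cvgMl.
by rewrite -[X in _ --> X]add0r; apply: cvgD; [exact: xG|apply: cvgMl; exact: xocc].
Qed.

End unique_stationary.

(** * Q-learning along a trajectory *)

Lemma le_qmax {R : realType} {Z A : finType} (Q : Z -> A -> R) z a : Q z a <= qmax Q z.
Proof. by rewrite /qmax; case: pickP => [a0 _|/(_ a)//]; exact: le_bigmax. Qed.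

(** The inhabitant of [A] rules out the default value 0 of [qmax], which [c] need not dominate. *)
Lemma qmax_le {R : realType} {Z A : finType} (Q : Z -> A -> R) z (c : R) :
  A -> (forall a, Q z a <= c) -> qmax Q z <= c.
Proof.
by rewrite /qmax => a Qc; case: pickP => [a0 _|/(_ a)//]; exact: bigmax_le.
Qed.

Lemma qmax_dist {R : realType} {Z A : finType} (Q Q' : Z -> A -> R) z (D : R) :
  A -> (forall a, `|Q z a - Q' z a| <= D) -> `|qmax Q z - qmax Q' z| <= D.
Proof.
move=> a0 QD; rewrite ler_norml; apply/andP; split.
  rewrite lerBrDr -lerBrDl opprK; apply: qmax_le => // a.
  by have := QD a; rewrite ler_norml => /andP[]; have := le_qmax Q z a; lra.
rewrite lerBlDr; apply: qmax_le => // a.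
by have := QD a; rewrite ler_norml => /andP[]; have := le_qmax Q' z a; lra.
Qed.

Lemma qmax_norm_le {R : realType} {Z A : finType} (Q : Z -> A -> R) z (B : R) :
  A -> (forall a, `|Q z a| <= B) -> `|qmax Q z| <= B.
Proof.
move=> a0 QB; rewrite ler_norml; apply/andP; split.
  by apply: le_trans (le_qmax Q z a0); have := QB a0; rewrite ler_norml => /andP[].
by apply: qmax_le => // a; have := QB a; rewrite ler_norml => /andP[].
Qed.

(** Separates the times before a bound takes effect: their contribution is constant in [n] and
    disappears after division by [n]. *)
Lemma sum_le_eventually {R : realType} (u c : nat -> R) (D : R) N :
  0 <= D -> (forall t, 0 <= c t) -> (forall t, (N <= t)%N -> u t <= D * c t) ->
  forall n, (N <= n)%N ->
  \sum_(t < n) u t <= \sum_(t < N) u t + D * \sum_(t < n) c t.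
Proof.
move=> D0 c0 uc n Nn.
rewrite -!(big_mkord xpredT) (big_cat_nat (leq0n N) Nn)//= lerD2l mulr_sumr.
rewrite [leRHS](big_cat_nat (leq0n N) Nn)//= -[leLHS]add0r lerD//.
  by apply: sumr_ge0 => t _; rewrite mulr_ge0.
by rewrite big_nat_cond [leRHS]big_nat_cond; apply: ler_sum => t /andP[/andP[? _] _]; exact: uc.
Qed.

Section q_learning_path.
Context {R : realType} {S Y Z A : finType}.
Variables (r : S -> A -> R) (gamma : R) (Q0 Qstar : Z -> A -> R).
Variable x : nat -> state S Y Z A.
Hypothesis gamma01 : 0 <= gamma < 1.

Definition at_pair (z : Z) (a : A) (y : state S Y Z A) : R :=
  if (zof y == z) && (aof y == a) then 1 else 0.

(** The error of the target computed with [Qstar], counted only at visits of the pair. Its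
    stationary mean vanishes when [Qstar] solves the fixed-point equation. *)
Definition bellman_residual (z : Z) (a : A) (y y' : state S Y Z A) : R :=
  at_pair z a y * (r (sof y) (aof y) + gamma * qmax Qstar (zof y') - Qstar z a).

Local Notation Q := (Qhat r gamma x Q0).
Local Notation count z a n := (\sum_(t < n) at_pair z a (x t)).

Lemma at_pair_ge0 z a y : 0 <= at_pair z a y.
Proof. by rewrite /at_pair; case: ifP. Qed.

Lemma count_ge0 z a n : 0 <= count z a n.
Proof. by apply: sumr_ge0 => t _; exact: at_pair_ge0. Qed.

(* With the [1 / (1 + visits)] learning rate, each entry of the table is the
   plain average of its initial value and of all its past targets. *)
Lemma Qhat_average z a n : (1 + count z a n) * Q n z a = Q0 z a +
  \sum_(t < n) at_pair z a (x t) *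
    (r (sof (x t)) (aof (x t)) + gamma * qmax (Q t) (zof (x t.+1))).
Proof.
elim: n => [|n IH]; first by rewrite !big_ord0 !addr0 mul1r.
rewrite [in RHS]big_ord_recr addrA -IH /= /alpha.
(* [visits] at time [n] includes the current step, so it is the count up to [n.+1]. *)
rewrite -[visits R x n z a]/(count z a n.+1) -/(at_pair z a (x n)) big_ord_recr/=.
have := count_ge0 z a n; move: (count z a n) => N N0.
rewrite /at_pair; case: ifP => [/andP[/eqP<- /eqP<-]|_]; last by rewrite !mul0r !addr0.
by field; lra.
Qed.

(** An updated entry is a convex combination of the old entry and the target, so a radius that
    targets preserve bounds all iterates. *)
Lemma Qhat_bounded : exists B, forall n z a, `|Q n z a| <= B.
Proof.
move: gamma01 => /andP[g0 g1].
pose rB := \sum_s \sum_a `|r s a|.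
have rle s a : `|r s a| <= rB by exact: le_sum2_norm.
have rB0 : 0 <= rB by apply: sumr_ge0 => i _; exact: sumr_ge0.
pose QB := \sum_z \sum_a `|Q0 z a|.
have Q0le z a : `|Q0 z a| <= QB by exact: le_sum2_norm.
have QB0 : 0 <= QB by apply: sumr_ge0 => i _; exact: sumr_ge0.
(* Chosen to dominate [Q0] and to satisfy [rB + gamma * B <= B]. *)
pose B := QB + rB / (1 - gamma).
have rB1 : 0 <= rB / (1 - gamma) by rewrite divr_ge0//; lra.
have BE : rB + gamma * B <= B.
  have : rB = (1 - gamma) * (rB / (1 - gamma)) by rewrite mulrC divfK//; lra.
  have : gamma * QB <= QB by rewrite ler_piMl// ltW.
  rewrite /B; lra.
exists B; elim=> [|n IH] z a; first by apply: le_trans (Q0le z a) _; rewrite /B; lra.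
rewrite /= /alpha -[visits R x n z a]/(count z a n.+1) -/(at_pair z a (x n)).
have := count_ge0 z a n; rewrite big_ord_recr/=; move: (count z a n) => N N0.
rewrite /at_pair; case: ifP => [/andP[/eqP<- /eqP<-]|_]; last by rewrite !mul0r addr0.
set tgt := r _ _ + _.
have tB : `|tgt| <= B.
  apply: le_trans BE; apply: le_trans (ler_normD _ _) _; rewrite lerD//.
  rewrite normrM (ger0_norm g0) ler_wpM2l//.
  by apply: qmax_norm_le (aof (x n)) _ => a'; exact: IH.
set q := Q n _ _; have qB : `|q| <= B by exact: IH.
have -> : q + 1 / (1 + (N + 1)) * (tgt - q) =
    (1 - (1 + (N + 1))^-1) * q + (1 + (N + 1))^-1 * tgt by field; lra.
have i0 : 0 <= (1 + (N + 1))^-1 by rewrite invr_ge0; lra.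
have i1 : (1 + (N + 1))^-1 <= 1 by rewrite invf_le1; lra.
move: (_^-1) i0 i1 => i i0 i1.
apply: le_trans (ler_normD _ _) _; rewrite !normrM (ger0_norm i0) ger0_norm ?subr_ge0//.
have -> : B = (1 - i) * B + i * B by ring.
by rewrite lerD// ler_wpM2l// subr_ge0.
Qed.

Hypothesis count_lim : forall z a, exists2 p, 0 < p &
  (fun n => count z a n / n%:R) @ \oo --> (p : R).
Hypothesis residual_lim : forall z a,
  (fun n => (\sum_(t < n) bellman_residual z a (x t) (x t.+1)) / n%:R) @ \oo --> (0 : R).

Lemma Qhat_error_average z a n : (1 + count z a n) * (Q n z a - Qstar z a) =
  (Q0 z a - Qstar z a) + \sum_(t < n) bellman_residual z a (x t) (x t.+1) +
  gamma * \sum_(t < n) at_pair z a (x t) *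
    (qmax (Q t) (zof (x t.+1)) - qmax Qstar (zof (x t.+1))).
Proof.
rewrite mulrBr Qhat_average mulrDl mul1r opprD addrACA -[RHS]addrA; congr (_ + _).
rewrite mulr_sumr mulr_suml -big_split -sumrB; apply: eq_bigr => t _ /=.
by rewrite /bellman_residual; ring.
Qed.

(** In the averaged error identity the initial terms and the residuals are o(n), while the count
    grows linearly. The remaining term is at most [gamma * D] times the count. *)
Lemma Qhat_error_contraction (D delta : R) : 0 <= D -> 0 < delta ->
  (\forall n \near \oo, forall z a, `|Q n z a - Qstar z a| <= D) ->
  \forall n \near \oo, forall z a, `|Q n z a - Qstar z a| <= gamma * D + delta.
Proof.
move: gamma01 => /andP[g0 g1] D0 delta0 [N _ ND].
apply: filter_forall => z; apply: filter_forall => a.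
have [p p0 cp] := count_lim z a.
pose e t := `|qmax (Q t) (zof (x t.+1)) - qmax Qstar (zof (x t.+1))|.
pose k := `|Q0 z a - Qstar z a| + gamma * \sum_(t < N) at_pair z a (x t) * e t.
(* The constant [k] and the residual sum will each be at most [delta * p / 4 * n]. Together they
   stay below [delta] times the count, which is eventually at least [p / 2 * n]. *)
have eta0 : 0 < delta * p / 4 by rewrite divr_gt0// mulr_gt0.
have kn : \forall n \near \oo, `|k / n%:R| <= delta * p / 4.
  by apply: (cvgr0Pnorm_le _).1 eta0; apply: (cvgn_bounded_div _ `|k|).
have Sn := (cvgr0Pnorm_le _).1 (residual_lim z a) _ eta0.
have p2 : 0 < p / 2 by rewrite divr_gt0.
have Nn := (cvgrPdist_le _ _).1 cp _ p2.
near=> n.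
have n0 : 0 < n%:R :> R by rewrite ltr0n; near: n; exists 1%N.
have Cn : 0 <= count z a n by exact: count_ge0.
have C1 : 0 < 1 + count z a n by lra.
rewrite -(ler_pM2l C1) -[X in X * `|_|](gtr0_norm C1) -normrM Qhat_error_average.
have kn' : k <= delta * p / 4 * n%:R.
  rewrite -ler_pdivrMr//; apply: le_trans (ler_norm _) _; near: n; exact: kn.
have Sn' : `|\sum_(t < n) bellman_residual z a (x t) (x t.+1)| <= delta * p / 4 * n%:R.
  rewrite -ler_pdivrMr// -[X in _ / X](gtr0_norm n0) -normf_div; near: n; exact: Sn.
have Nn' : p / 2 * n%:R <= count z a n.
  have : `|p - count z a n / n%:R| <= p / 2 by near: n; exact: Nn.
  rewrite ler_norml => /andP[_]; rewrite -ler_pdivlMr//; lra.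
have sum_e : \sum_(t < n) at_pair z a (x t) * e t <=
    \sum_(t < N) at_pair z a (x t) * e t + D * count z a n.
  have NN : (N <= n)%N by near: n; exists N.
  apply: (sum_le_eventually (fun t => at_pair z a (x t) * e t)
    (fun t => at_pair z a (x t)) D N D0 _ _ n NN) => [t|t Nt]; first exact: at_pair_ge0.
  rewrite mulrC ler_wpM2r ?at_pair_ge0//; apply: qmax_dist (aof (x t)) _ => a'.
  exact: ND.
apply: (@le_trans _ _ (k + `|\sum_(t < n) bellman_residual z a (x t) (x t.+1)|
    + gamma * (D * count z a n))).
  apply: le_trans (ler_normD _ _) _.
  apply: le_trans (lerD (ler_normD _ _) (lexx _)) _.
  rewrite normrM (ger0_norm g0).
  have : `|\sum_(t < n) at_pair z a (x t) * (qmax (Q t) (zof (x t.+1)) - qmax Qstar (zof (x t.+1)))|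
      <= \sum_(t < n) at_pair z a (x t) * e t.
    apply: le_trans (ler_norm_sum _ _ _) _; apply: ler_sum => t _.
    by rewrite normrM ger0_norm ?at_pair_ge0.
  move=> /le_trans/(_ sum_e)/(ler_wpM2l g0); rewrite /k; lra.
have := ler_wpM2l (ltW delta0) Nn'.
have : 0 <= gamma * D by rewrite mulr_ge0.
lra.
Unshelve. all: by end_near. Qed.

Lemma Qhat_cvg z a : (fun n => Q n z a) @ \oo --> Qstar z a.
Proof.
move: (gamma01) => /andP[g0 g1].
have [B QB] := Qhat_bounded.
pose D := B + \sum_z \sum_a `|Qstar z a| + 1.
have Qsle z' a' : `|Qstar z' a'| <= \sum_z \sum_a `|Qstar z a|.
  exact: le_sum2_norm.
have D0 : 0 < D.
  have : 0 <= B by apply: le_trans (QB 0%N z a).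
  have : 0 <= \sum_z \sum_a `|Qstar z a| by apply: le_trans (Qsle z a).
  rewrite /D; lra.
(* Taking [delta] as [(1 - gamma) / 2] times the current radius makes each round shrink it by
   exactly [rho < 1]. Since [rho] is positive even for [gamma = 0], the radii stay positive. *)
pose rho := (1 + gamma) / 2.
have rho0 : 0 < rho by rewrite /rho; lra.
have Qrho k : \forall n \near \oo, forall z a, `|Q n z a - Qstar z a| <= rho ^+ k * D.
  elim: k => [|k IH].
    apply: nearW => n z' a'; rewrite expr0 mul1r.
    apply: le_trans (ler_normB _ _) _.
    have := QB n z' a'; have := Qsle z' a'; rewrite /D; lra.
  have Dk : 0 < rho ^+ k * D by rewrite mulr_gt0// exprn_gt0.
  have := @Qhat_error_contraction (rho ^+ k * D) ((1 - gamma) / 2 * (rho ^+ k * D))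
    (ltW Dk) (mulr_gt0 _ Dk) IH.
  move=> /(_ ltac:(lra)); apply: filterS => n Qn z' a'.
  by apply: le_trans (Qn z' a') _; rewrite exprS /rho; lra.
apply/cvgrPdist_le => eps eps0.
have : (fun k => rho ^+ k * D) @ \oo --> 0 * D.
  by apply: cvgMl; apply: cvg_expr; rewrite gtr0_norm// /rho; lra.
rewrite mul0r => /cvgr0Pnorm_le/(_ _ eps0)[k _ /(_ k (leqnn k))/= kD].
have := Qrho k; apply: filterS => n /(_ z a) Qn.
by rewrite distrC (le_trans Qn)// (le_trans (ler_norm _)).
Qed.

End q_learning_path.

(** * Stationary averages of the POMDP chain *)

Section pomdp_chain.
Context {R : realType} {S Y Z A : finType}.
Variables (P : S -> A -> S -> R) (O : S -> A -> Y -> R) (r : S -> A -> R).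
Variables (gamma : R) (f : Z -> Y -> A -> Z) (pi : Z -> A -> R).
Hypotheses (hP : forall s a, is_dist (P s a)) (hO : forall s a, is_dist (O s a)).
Hypothesis hpi : forall z, is_dist (pi z).

Local Notation K := (chain_kernel P O f pi).

Lemma sum_state (F : state S Y Z A -> R) :
  \sum_x F x = \sum_s \sum_y \sum_z \sum_a F (s, y, z, a).
Proof. by rewrite !pair_bigA; apply: eq_bigr => -[[[]]]. Qed.

(** As [v] sees only the next agent state, the action probabilities sum to one and the indicator
    selects the value of [f]. Constant [v] gives the row sums, [qmax Qstar] the expected target. *)
Lemma sum_chain_kernel (x : state S Y Z A) (v : Z -> R) :
  \sum_x' K x x' * v (zof x') =
  \sum_s' P (sof x) (aof x) s' *
    \sum_y' O s' (aof x) y' * v (f (zof x) y' (aof x)).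
Proof.
rewrite sum_state; apply: eq_bigr => s' _; rewrite mulr_sumr; apply: eq_bigr => y' _.
rewrite (bigD1 (f (zof x) y' (aof x)))//= [X in _ + X]big1 ?addr0 => [|z' /negbTE zf].
  under eq_bigr do rewrite /chain_kernel /sof /yof /zof /aof/= eqxx mulr1 mulrAC.
  by rewrite -mulr_sumr (hpi _).2 mulr1 mulrA.
by apply: big1 => a' _; rewrite /chain_kernel /zof/= zf mulr0 !mul0r.
Qed.

Lemma chain_kernel_dist x : is_dist (K x).
Proof.
split=> [x'|].
  rewrite /chain_kernel !mulr_ge0 ?(hP _ _).1 ?(hO _ _).1 ?(hpi _).1//.
  by case: ifP.
transitivity (\sum_x' K x x' * (fun=> 1) (zof x')).
  by apply: eq_bigr => x' _; rewrite mulr1.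
rewrite (sum_chain_kernel x (fun=> 1)).
under eq_bigr do under eq_bigr do rewrite mulr1.
under eq_bigr do rewrite (hO _ _).2 mulr1.
exact: (hP _ _).2.
Qed.

Variable xi : state S Y Z A -> R.
Hypothesis xi_pos : forall x, 0 < xi x.

Lemma sum_at_pair z a (g : S -> R) :
  \sum_x xi x * (at_pair z a x * g (sof x)) = \sum_s xi_sza xi s z a * g s.
Proof.
rewrite sum_state; apply: eq_bigr => s _; rewrite mulr_suml; apply: eq_bigr => y _.
rewrite (bigD1 z)//= (bigD1 a)//= /at_pair /zof /aof/= !eqxx mul1r.
rewrite big1 ?addr0 => [|a' /negbTE->]; last by rewrite andbF mul0r mulr0.
rewrite big1 ?addr0// => z' /negbTE->.
by apply: big1 => a' _; rewrite /= mul0r mulr0.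
Qed.

(** The point [x] supplies a state and an observation, so the double sum is not empty. *)
Lemma xi_za_gt0 (x : state S Y Z A) z a : 0 < xi_za xi z a.
Proof.
rewrite /xi_za /xi_sza (bigD1 (sof x))//= (bigD1 (yof x))//= -addrA.
rewrite ltr_wpDr// addr_ge0//; first by apply: sumr_ge0 => y _; exact: ltW.
by apply: sumr_ge0 => s _; apply: sumr_ge0 => y _; exact: ltW.
Qed.

Lemma mean_at_pair z a :
  \sum_x \sum_x' xi x * K x x' * at_pair z a x = xi_za xi z a.
Proof.
transitivity (\sum_x xi x * (at_pair z a x * (fun=> 1) (sof x))).
  apply: eq_bigr => x _; rewrite -mulr_suml -mulr_sumr (chain_kernel_dist x).2.
  by rewrite !mulr1.
by rewrite (sum_at_pair z a (fun=> 1)); apply: eq_bigr => s _; rewrite mulr1.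
Qed.

Variable Qstar : Z -> A -> R.
Hypothesis hQstar : forall z a, Qstar z a = r_xi xi r z a
  + gamma * \sum_(z' : Z) P_xi xi P O f z' z a * qmax Qstar z'.

(** Puts the expectation under [P_xi] in the form produced by [sum_chain_kernel], so that the two
    can be matched. *)
Lemma sum_P_xi z a (v : Z -> R) : \sum_z' P_xi xi P O f z' z a * v z' =
  \sum_s xi_cond xi s z a *
    \sum_s' P s a s' * \sum_y' O s' a y' * v (f z y' a).
Proof.
under [LHS]eq_bigr do rewrite mulr_suml.
rewrite [LHS]exchange_big; apply: eq_bigr => s _ /=.
under [LHS]eq_bigr do rewrite -mulrA.
rewrite -[LHS]mulr_sumr; congr (_ * _).
under [LHS]eq_bigr do rewrite mulr_suml.
rewrite [LHS]exchange_big; apply: eq_bigr => s' _ /=.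
under [LHS]eq_bigr do rewrite -mulrA.
rewrite -[LHS]mulr_sumr; congr (_ * _).
under [LHS]eq_bigr do rewrite mulr_suml.
rewrite [LHS]exchange_big; apply: eq_bigr => y' _ /=.
rewrite (bigD1 (f z y' a))//= eqxx mulr1 big1 ?addr0// => z' /negbTE->.
by rewrite mulr0 mul0r.
Qed.

(** Restricted to the pair, [xi] is [xi_za] times the conditional law of the state, so the mean is
    [xi_za] times the defect of [Qstar] in its fixed-point equation. *)
Lemma mean_bellman_residual (x0 : state S Y Z A) z a :
  \sum_x \sum_x' xi x * K x x' * bellman_residual r gamma Qstar z a x x' = 0.
Proof.
pose W s := \sum_s' P s a s' * \sum_y' O s' a y' * qmax Qstar (f z y' a).
transitivity (\sum_x xi x * (at_pair z a x *
    (fun s => r s a + gamma * W s - Qstar z a) (sof x))).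
  apply: eq_bigr => x _.
  transitivity (xi x * (at_pair z a x * ((r (sof x) (aof x) - Qstar z a) * \sum_x' K x x' +
      gamma * \sum_x' K x x' * qmax Qstar (zof x')))).
    rewrite !mulr_sumr -big_split/= !mulr_sumr; apply: eq_bigr => x' _.
    by rewrite /bellman_residual; ring.
  rewrite (chain_kernel_dist x).2 mulr1 sum_chain_kernel /at_pair.
  case: ifP => [/andP[/eqP -> /eqP ->]|_]; last by rewrite !mul0r.
  by rewrite -/(W _); ring.
have xi0 : xi_za xi z a != 0 by rewrite gt_eqF// (xi_za_gt0 x0).
rewrite (sum_at_pair z a (fun s => r s a + gamma * W s - Qstar z a)).
under eq_bigr do rewrite mulrBr.
rewrite sumrB -mulr_suml -/(xi_za xi z a) [in X in _ - X]hQstar sum_P_xi.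
rewrite mulrDr mulrCA !mulr_sumr -big_split/= -sumrB big1// => s _.
by rewrite /xi_cond -/(W s); field.
Qed.

End pomdp_chain.

(** * Stability of greedy policies *)

Lemma greedyP {R : realType} {Z A : finType} (a0 : A) (Q : Z -> A -> R) z a :
  Q z a <= Q z (greedy a0 Q z).
Proof. by rewrite /greedy; case: arg_maxP => // b _; apply. Qed.

Lemma greedy_unique {R : realType} {Z A : finType} (a0 : A) (Q : Z -> A -> R) z a :
  (forall b, b != a -> Q z b < Q z a) -> greedy a0 Q z = a.
Proof.
move=> Qlt; apply/eqP/negPn/negP => /Qlt.
by rewrite ltNge greedyP.
Qed.

(** A unique maximizer leads every other action by a positive gap, and finitely many gaps survive
    small errors. With a tie in [Qstar], arbitrarily small errors could change the arg-max. *)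
Lemma greedy_stable {R : realType} {Z A : finType} (a0 : A) (Q : nat -> Z -> A -> R)
    (Qstar : Z -> A -> R) :
  (forall z a a', Qstar z a = qmax Qstar z -> Qstar z a' = qmax Qstar z -> a = a') ->
  (forall z a, (fun t => Q t z a) @ \oo --> Qstar z a) ->
  \forall t \near \oo, forall z, greedy a0 (Q t) z = greedy a0 Qstar z.
Proof.
move=> uniq_max Q_cvg; apply: filter_forall => z.
set g := greedy a0 Qstar z.
have gmax : Qstar z g = qmax Qstar z.
  apply: le_anti; rewrite le_qmax/=.
  by apply: (qmax_le Qstar z _ a0) => a; exact: greedyP.
have gap a : a != g -> Qstar z a < Qstar z g.
  rewrite lt_neqAle greedyP andbT; apply: contraNN => /eqP ag.
  by apply/eqP; apply: (uniq_max z) => //; rewrite ag.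
have : \forall t \near \oo, forall a, a != g -> Q t z a < Q t z g.
  apply: filter_forall => a.
  have [->|ag] := eqVneq a g; first by apply: nearW => t.
  (* Two errors of a third of the gap each leave a third, so the inequality stays strict. *)
  have e0 : 0 < (Qstar z g - Qstar z a) / 3 by rewrite divr_gt0// subr_gt0 gap.
  have h1 := (cvgrPdist_le _ _).1 (Q_cvg z a) _ e0.
  have h2 := (cvgrPdist_le _ _).1 (Q_cvg z g) _ e0.
  near=> t => _.
  have : `|Qstar z a - Q t z a| <= (Qstar z g - Qstar z a) / 3 by near: t; exact: h1.
  have : `|Qstar z g - Q t z g| <= (Qstar z g - Qstar z a) / 3 by near: t; exact: h2.
  by rewrite !ler_norml => /andP[_ +] /andP[+ _]; lra.
by apply: filterS => t; exact: greedy_unique.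
Unshelve. all: by end_near. Qed.

(** * Almost sure convergence of the iterates and their greedy policies *)

Theorem theorem2 (R : realType) (S Y Z A : finType)
  (P : S -> A -> S -> R) (O : S -> A -> Y -> R) (r : S -> A -> R) (gamma : R)
  (f : Z -> Y -> A -> Z) (pi : Z -> A -> R)
  (hP : forall s a, is_dist (P s a))
  (hO : forall s' a, is_dist (O s' a))
  (hgamma : 0 <= gamma < 1)
  (hpi : forall z, is_dist (pi z))
  (xi : state S Y Z A -> R)
  (hxi_stat : is_stationary (chain_kernel P O f pi) xi)
  (hxi_uniq : forall xi', is_stationary (chain_kernel P O f pi) xi' -> xi' = xi)
  (hxi_pos : forall x, 0 < xi x)
  (Qstar : Z -> A -> R)
  (hQstar : forall z a, Qstar z a = r_xi xi r z a
       + gamma * \sum_(z' : Z) P_xi xi P O f z' z a * qmax Qstar z')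
  (d : measure_display) (T : measurableType d) (Pr : probability T R)
  (X : nat -> T -> state S Y Z A) (mu0 : state S Y Z A -> R)
  (hmu0 : is_dist mu0)
  (hXmeas : forall t x, measurable [set w : T | X t w = x])
  (hXlaw : forall (x : nat -> state S Y Z A) (n : nat),
     Pr [set w : T | forall t, (t <= n)%N -> X t w = x t]
     = (mu0 (x 0%N) * \prod_(t < n) chain_kernel P O f pi (x t) (x t.+1))%:E)
  (Q0 : Z -> A -> R) :
  {ae Pr, forall w, forall z a,
     (fun t => Qhat r gamma (fun k => X k w) Q0 t z a) @ \oo --> Qstar z a}
  /\
  ((forall z a a', Qstar z a = qmax Qstar z -> Qstar z a' = qmax Qstar z -> a = a') ->
   forall a0 : A,
   {ae Pr, forall w, \forall t \near \oo, forall z,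
     greedy a0 (Qhat r gamma (fun k => X k w) Q0 t) z = greedy a0 Qstar z}).
Proof.
have K_dist := chain_kernel_dist P O f pi hP hO hpi.
have [xi_dist xi_stat] := hxi_stat.
(* The initial distribution has mass one, so the state space is not empty. *)
have [x0 _] : exists x0 : state S Y Z A, True.
  case: (pickP (@predT (state S Y Z A))) => [x0 _|E0]; first by exists x0.
  have := hmu0.2; rewrite big1 => [/esym/eqP|x _]; first by rewrite oner_eq0.
  by have := E0 x.
have X_increments : {ae Pr, forall w, forall a b, (fun n => (\sum_(t < n)
    (X t w == a)%:R * ((X t.+1 w == b)%:R - chain_kernel P O f pi a b)) / n%:R)
    @ \oo --> (0 : R)}.
  (* There are finitely many pairs, so one null set serves them all. *)
  apply: filter_forall => a; apply: filter_forall => b.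
  apply: (martingale_mean_cvg0 _ _ hmu0 K_dist _ _ hXmeas hXlaw (fun x y =>
    (x == a)%:R * ((y == b)%:R - chain_kernel P O f pi a b))) => x.
  have [->|_] := eqVneq x a; last by apply: big1 => y _; rewrite mul0r mulr0.
  under eq_bigr do rewrite mul1r mulrBr.
  rewrite sumrB -mulr_suml (K_dist a).2 mul1r (bigD1 b)//= eqxx mulr1.
  rewrite big1 ?addr0 ?subrr// => y /negbTE->.
  by rewrite mulr0.
have Q_cvg : {ae Pr, forall w, forall z a,
    (fun t => Qhat r gamma (fun k => X k w) Q0 t z a) @ \oo --> Qstar z a}.
  (* From here on the argument is deterministic along the path of [w]. *)
  apply: filterS X_increments => w Xw.
  have mean g := transition_mean_cvg _ xi K_dist xi_dist hxi_pos xi_stat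
    (fun nu h1 h2 => hxi_uniq nu (conj h1 h2)) (X ^~ w) g Xw.
  apply: Qhat_cvg => // z a.
    exists (xi_za xi z a); first exact: xi_za_gt0 x0 z a.
    rewrite -(mean_at_pair P O f pi hP hO hpi).
    exact: (mean (fun x _ => at_pair z a x)).
  have := mean (bellman_residual r gamma Qstar z a).
  by rewrite (mean_bellman_residual P O r gamma f pi hP hO hpi xi hxi_pos Qstar hQstar x0).
split=> [//|uniq_max a0]; apply: filterS Q_cvg => w; exact: greedy_stable.
Qed.
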